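(* Let $K$ be a pre-$\lambda$-ring (not necessarily with unity) which satisfies the composition axiom $$\lambda^k(\lambda^l(x))=P_{k,l}(\lambda^1(x),\lambda^2(x),\dots,\lambda^{kl}(x))\quad\text{for all }x\in K\text{ and }k,l\ge1.$$ Then $K$ is a $\lambda$-ring; i.e., $K$ also satisfies the product axiom $$\lambda^k(xy)=P_k(\lambda^1(x),\dots,\lambda^k(x);\lambda^1(y),\dots,\lambda^k(y))\quad\text{for all }x,y\in K\text{ and }k\ge1.$$
   Context: A pre-$\lambda$-ring is a commutative ring $K$ (not necessarily with unity) together with maps $\lambda^k\colon K\to K$, $k\ge1$, such that $\lambda^1(x)=x$ for all $x\in K$ and $\lambda^k(x+y)=\sum_{i=0}^k\lambda^{k-i}(x)\lambda^i(y)$ for all $x,y\in K$ and $k\ge1$. There is no $\lambda^0$: by convention the term $\lambda^0(x)\lambda^k(y)$ means $\lambda^k(y)$, and $\lambda^k(x)\lambda^0(y)$ means $\lambda^k(x)$. A $\lambda$-ring is a pre-$\lambda$-ring satisfying both the product axiom and the composition axiom displayed in the claim. $P_k$ and $P_{k,l}$ are the usual universal integral polynomials (without constant term): with $e_i$ denoting the $i$th elementary symmetric polynomial, $P_k\in\mathbb{Z}[X_1,\dots,X_k;Y_1,\dots,Y_k]$ is determined by the requirement that $P_k(e_1(S),\dots,e_k(S);e_1(T),\dots,e_k(T))$ is the coefficient of $t^k$ in $\prod_{i,j}(1+S_iT_jt)$ (for variables $S_1,\dots,S_m$, $T_1,\dots,T_m$, $m\ge k$), and $P_{k,l}\in\mathbb{Z}[X_1,\dots,X_{kl}]$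 by the requirement that $P_{k,l}(e_1(S),\dots,e_{kl}(S))$ is the coefficient of $t^k$ in $\prod_{i_1<\dots<i_l}(1+S_{i_1}\cdots S_{i_l}t)$ (for variables $S_1,\dots,S_m$, $m\ge kl$). *)

(* Defs.v *)
From HB Require Import structures.
From mathcomp Require Import all_boot all_order all_fingroup all_algebra.
From mathcomp Require Import mpoly.

Set Implicit Arguments.
Unset Strict Implicit.
Unset Printing Implicit Defensive.

Import GRing.Theory.
Local Open Scope ring_scope.

(* In the variables of P, lshift k a stands for X_(a+1) and rshift k b for
   Y_(b+1); in {mpoly int[m + m]}, lshift m i stands for S_(i+1) and
   rshift m j for T_(j+1). *)
Definition univ_prod_spec k (P : {mpoly int[k + k]}) :=
  forall m, (k <= m)%N ->
    P \mPo [tuple match split i with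
                  | inl a => mesym m int a.+1 \mPo [tuple 'X_(lshift m j) | j < m]
                  | inr b => mesym m int b.+1 \mPo [tuple 'X_(rshift m j) | j < m]
                  end | i < k + k]
    = (\prod_(i < m) \prod_(j < m)
         (1 + ('X_(lshift m i) * 'X_(rshift m j)) *: 'X))`_k
    :> {mpoly int[m + m]}.

Definition univ_comp_spec k l (P : {mpoly int[k * l]}) :=
  forall m, (k * l <= m)%N ->
    P \mPo [tuple mesym m int i.+1 | i < k * l]
    = (\prod_(A : {set 'I_m} | #|A| == l) (1 + (\prod_(i in A) 'X_i) *: 'X))`_k
    :> {mpoly int[m]}.

Section Morphisms.
Variables (R : comNzRingType).

Lemma mpoly_rmorph_eq n (S : nzRingType) (f g : {rmorphism {mpoly R[n]} -> S}) :
  (forall c, f c%:MP = g c%:MP) -> (forall i, f 'X_i = g 'X_i) -> f =1 g.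
Proof.
move=> fgC fgX p; rewrite [p]mpolyE !rmorph_sum; apply: eq_bigr => m _.
rewrite -mul_mpolyC mpolyXE_id !rmorphM fgC !rmorph_prod; congr (_ * _).
by apply: eq_bigr => i _; rewrite !rmorphXn fgX.
Qed.

Lemma mmap_ext n (S : nzRingType) (f : R -> S) (g h : 'I_n -> S) p :
  g =1 h -> mmap f g p = mmap f h p.
Proof. by move=> gh; apply: eq_bigr => m _; rewrite (mmap1_eq _ gh). Qed.

Lemma mmap_extf n (S : nzRingType) (f f' : R -> S) (g : 'I_n -> S) p :
  f =1 f' -> mmap f g p = mmap f' g p.
Proof. by move=> ff'; apply: eq_bigr => m _; rewrite ff'. Qed.

Lemma map_mpoly_inj n (S : nzRingType) (f : {rmorphism R -> S}) :
  injective f -> injective (map_mpoly f : {mpoly R[n]} -> {mpoly S[n]}).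
Proof.
move=> f_inj p q pq; apply/mpolyP => mu; apply: f_inj.
by rewrite -!mcoeff_map_mpoly pq.
Qed.

End Morphisms.

Section Homogeneous.
Variables (R : comNzRingType) (n l : nat).

Definition graded (G : {poly {mpoly R[n]}}) :=
  forall j, G`_j \is [in R[n], (j * l).-homog].

Lemma graded1 : graded 1.
Proof.
move=> j; rewrite coef1; case: j => [|j] /=; last exact: rpred0.
exact: dhomog1.
Qed.

Lemma gradedM G H : graded G -> graded H -> graded (G * H).
Proof.
move=> hG hH j; rewrite coefM; apply: rpred_sum => i _.
have -> : (j * l = i * l + (j - i) * l)%N by rewrite -mulnDl subnKC // -ltnS.
exact: dhomogM.
Qed.

Lemma graded_prod (I : finType) (P : pred I) F :
  (forall i, P i -> graded (F i)) -> graded (\prod_(i | P i) F i).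
Proof. by move=> hF; elim/big_ind: _ => //; [exact: graded1 | exact: gradedM]. Qed.

Lemma dhomog_msize_le d (p : {mpoly R[n]}) :
  p \is [in R[n], d.-homog] -> (msize p <= d.+1)%N.
Proof.
move=> /dhomogP hp; rewrite msizeE; apply/bigmax_leqP_seq => m mp _.
by rewrite (hp m mp).
Qed.

End Homogeneous.

Section Restriction.
Variables (R : comNzRingType).

Definition resX d (i : nat) : {mpoly R[d]} :=
  if insub i is Some j then 'X_j else 0.

Definition res m d : {mpoly R[m]} -> {mpoly R[d]} :=
  comp_mpoly [tuple resX d i | i < m].
HB.instance Definition _ m d := GRing.RMorphism.on (@res m d).

Lemma resX_lt d i (lti : (i < d)%N) : resX d i = 'X_(Ordinal lti).
Proof. by rewrite /resX insubT. Qed.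

Lemma resX_ge d i : (d <= i)%N -> resX d i = 0.
Proof. by move=> ledi; rewrite /resX insubF // ltnNge ledi. Qed.

Lemma resXE m d (i : 'I_m) : res d 'X_i = resX d i.
Proof. by rewrite [LHS]mmapX mmap1U tnth_mktuple. Qed.

Lemma resC m d c : res d (c%:MP_[m]) = c%:MP.
Proof. by rewrite [LHS]mmapC. Qed.

Lemma res_prod_set m d (lemd : (d <= m)%N) (A : {set 'I_m}) :
  res d (\prod_(i in A) 'X_i) =
  if A \subset [set i : 'I_m | (i < d)%N] then
     \prod_(i in widen_ord lemd @^-1: A) 'X_i else 0.
Proof.
rewrite rmorph_prod; case: ifPn => [/subsetP sA|/subsetPn[i iA]]; last first.
  rewrite inE -leqNgt => ledi.
  by rewrite (bigD1 i) //= resXE resX_ge // mul0r.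
have -> : A = [set widen_ord lemd j | j in widen_ord lemd @^-1: A].
  apply/setP=> i; apply/idP/imsetP => [iA|[j]]; last by rewrite inE => jA ->.
  have := sA i iA; rewrite inE => lti; exists (Ordinal lti); last exact: val_inj.
  by rewrite inE (_ : widen_ord _ _ = i) //; apply: val_inj.
rewrite big_imset /=; last by move=> x y _ _ [xy]; apply: val_inj.
have widen_inj : injective (widen_ord lemd).
  by move=> x y [xy]; apply: val_inj.
rewrite [in RHS](_ : widen_ord lemd @^-1: _ = widen_ord lemd @^-1: A).
  apply: eq_bigr => j _; rewrite resXE /= (resX_lt (ltn_ord j)).
  by congr 'X_(_); apply: val_inj.
by apply/setP=> j; rewrite !inE mem_imset // inE.
Qed.

Lemma big_subset_narrow (T : Type) (idx : T) (op : Monoid.com_law idx) m d l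
    (lemd : (d <= m)%N) (F : {set 'I_d} -> T) :
  \big[op/idx]_(A : {set 'I_m} | (#|A| == l)
                  && (A \subset [set i : 'I_m | (i < d)%N]))
     F (widen_ord lemd @^-1: A)
  = \big[op/idx]_(B : {set 'I_d} | #|B| == l) F B.
Proof.
have winj : injective (widen_ord lemd) by move=> x y [xy]; apply: val_inj.
have wK (B : {set 'I_d}) : widen_ord lemd @^-1: (widen_ord lemd @: B) = B.
  by apply/setP=> j; rewrite !inE mem_imset.
rewrite (reindex_onto (fun B : {set 'I_d} => widen_ord lemd @: B)
   (fun A => widen_ord lemd @^-1: A)) /=; last first.
  move=> A /andP[_ /subsetP sA]; apply/setP=> i.
  apply/imsetP/idP => [[j]|iA]; first by rewrite inE => jA ->.
  have := sA i iA; rewrite inE => lti; exists (Ordinal lti); last exact: val_inj.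
  by rewrite inE (_ : widen_ord _ _ = i) //; apply: val_inj.
apply: eq_big => [B|B _]; last by rewrite wK.
rewrite wK eqxx andbT card_imset // andb_idr // => _.
by apply/subsetP=> i /imsetP[j _ ->]; rewrite inE /=.
Qed.

Lemma res_mesym m d k : (d <= m)%N -> res d (mesym m R k) = (mesym d R k).
Proof.
move=> lemd; rewrite /mesym rmorph_sum /=.
under eq_bigr do rewrite (res_prod_set lemd).
rewrite -big_mkcondr /=.
exact: (big_subset_narrow _ _ lemd (fun B => \prod_(i in B) 'X_i)).
Qed.

Lemma stable_sym d (F : forall m, {mpoly R[m]}) :
  (forall m, F m \is symmetric) -> (forall m, (msize (F m) <= d.+1)%N) ->
  (forall m, (d <= m)%N -> res d (F m) = F d) ->
  {P : {mpoly R[d]} |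
    forall m, (d <= m)%N -> P \mPo [tuple mesym m R i.+1 | i < d] = F m}.
Proof.
move=> Fsym Fsize Fres; have [P [PE _]] := sym_fundamental (Fsym d).
exists P => m ledm; have [t [tE tw]] := sym_fundamental (Fsym m).
have t0 mu (i : 'I_m) : mu \in msupp t -> (d <= i)%N -> mu i = 0%N.
  move=> mut ledi; apply: contraTeq (leq_trans tw (Fsize m)) => mui.
  rewrite -ltnNge (leq_trans _ (mmeasure_mnm_lt _ mut)) // !ltnS.
  rewrite /= /mnmwgt (bigD1 i) //=.
  by rewrite (leq_trans _ (leq_addr _ _)) // (leq_trans _ (leq_pmull _ _)) ?lt0n.
have key n (s : nat -> {mpoly R[n]}) :
    t \mPo [tuple s i | i < m] = res d t \mPo [tuple s i | i < d].
  have E : res d t \mPo [tuple s i | i < d]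
           = t \mPo [tuple if (i < d)%N then s i else 0 | i < m].
    apply: (@mpoly_rmorph_eq _ _ _ (comp_mpoly _ \o @res m d) (comp_mpoly _)).
      by move=> c; rewrite /= resC !comp_mpolyC.
    move=> i; rewrite /= resXE [RHS]mmapX mmap1U tnth_mktuple.
    case: ltnP => [lti|lei]; last by rewrite resX_ge // comp_mpoly0.
    by rewrite (resX_lt lti) [LHS]mmapX mmap1U tnth_mktuple.
  rewrite E !comp_mpolyE big_seq [RHS]big_seq; apply: eq_bigr => mu mut.
  congr (_ *: _); apply: eq_bigr => i _; rewrite !tnth_mktuple.
  by case: ltnP => // lei; rewrite (t0 mu i) // !expr0.
suff -> : P = res d t by rewrite -(key m (fun i => mesym m R i.+1)).
apply: msym_fundamental_un; rewrite PE -(Fres m ledm) -tE.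
rewrite -(key d (fun i => mesym d R i.+1)).
pose f : {rmorphism {mpoly R[m]} -> {mpoly R[d]}} :=
  @res m d \o comp_mpoly [tuple mesym m R i.+1 | i < m].
rewrite -[LHS]/(f t).
apply: (@mpoly_rmorph_eq _ _ _ f (comp_mpoly [tuple mesym d R i.+1 | i < m])).
  by move=> c; rewrite /= !comp_mpolyC resC.
by move=> i; rewrite /= [in LHS]/comp_mpoly mmapX mmap1U
  [RHS]mmapX mmap1U !tnth_mktuple res_mesym.
Qed.

End Restriction.

Section MSym.
Variables (R : comNzRingType) (n : nat).

Lemma msymXU (s : 'S_n) i : msym s 'X_i = 'X_(s i) :> {mpoly R[n]}.
Proof. by rewrite [LHS]mmapX mmap1U. Qed.

Lemma coef_msym (s : 'S_n) (G : {poly {mpoly R[n]}}) j :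
  msym s G`_j = (map_poly (msym s) G)`_j.
Proof. by rewrite coef_map. Qed.
End MSym.

Section CoefUpTo.
Variables (A : comNzRingType) (k : nat).

Lemma eq_coef_prod (I : finType) (F G : I -> {poly A}) :
  (forall i j, (j <= k)%N -> (F i)`_j = (G i)`_j) ->
  (\prod_i F i)`_k = (\prod_i G i)`_k.
Proof.
move=> FG; pose E (f g : {poly A}) := forall j, (j <= k)%N -> f`_j = g`_j.
suff : E (\prod_i F i) (\prod_i G i) by apply.
elim/big_ind2: _ => // [p p' q q' pp' qq' j lejk|i _ j]; last exact: FG.
rewrite !coefM; apply: eq_bigr => i _; rewrite pp' ?qq' //.
  by rewrite (leq_trans _ lejk) ?leq_subr.
by rewrite (leq_trans _ lejk) // -ltnS.
Qed.

Lemma prod_1DX (n : nat) (c : 'I_n -> A) j :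
  (\prod_(i < n) (1 + c i *: 'X))`_j
  = \sum_(B : {set 'I_n} | #|B| == j) \prod_(i in B) c i.
Proof.
under eq_bigr do rewrite addrC.
rewrite bigA_distr coef_sum [RHS]big_mkcond /=; apply: eq_bigr => B _.
rewrite -big_mkcond /=.
have -> : \prod_(i in B) (c i *: 'X) = (\prod_(i in B) c i) *: 'X^#|B|.
  rewrite -[#|B|]sum1_card -prodrXr -scaler_prod.
  by apply: eq_bigr => i _; rewrite expr1.
by rewrite coefZ coefXn eq_sym; case: eqP; rewrite ?mulr1 ?mulr0.
Qed.
End CoefUpTo.

Section Comp.
Variables (k l : nat).

Definition genC m : {poly {mpoly int[m]}} :=
  \prod_(A : {set 'I_m} | #|A| == l) (1 + (\prod_(i in A) 'X_i) *: 'X).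

Lemma genC_sym m : (genC m)`_k \is symmetric.
Proof.
apply/issymP=> s; rewrite coef_msym rmorph_prod; congr ((polyseq _)`_k).
rewrite /genC [RHS](reindex_inj (h := fun A : {set 'I_m} => s @: A)) /=; last first.
  by apply: imset_inj; apply: perm_inj.
apply: eq_big => [A|A _]; first by rewrite card_imset //; apply: perm_inj.
rewrite rmorphD rmorph1 /= map_polyZ map_polyX rmorph_prod /=.
congr (_ + _ *: _); rewrite big_imset /=; last by move=> x y _ _ /perm_inj.
by apply: eq_bigr => i _; rewrite msymXU.
Qed.

Lemma genC_graded m : graded l (genC m).
Proof.
apply: graded_prod => A /eqP Al j; rewrite coefD coef1 coefZ coefX.
have hA : \prod_(i in A) 'X_i \is [in int[m], l.-homog].
  have -> : \prod_(i in A) 'X_i = 'X_[mesym1 A] :> {mpoly int[m]}.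
    rewrite mprodXE; congr 'X_[_]; apply/mnmP=> i.
    rewrite mnmE mnm_sumE big_mkcond (bigD1 i) //= mnmE eqxx big1 ?addn0 // => j' ne.
    by case: ifP => // _; rewrite mnmE (negbTE ne).
  by rewrite dhomogX /= mdeg_mesym1 Al.
case: j => [|[|j]] /=; rewrite ?mulr0 ?mulr1 ?addr0 ?add0r ?rpred0 //.
  exact: dhomog1.
by rewrite mul1n.
Qed.

Lemma genC_res m d : (d <= m)%N -> res d (genC m)`_k = (genC d)`_k.
Proof.
move=> lemd; rewrite -coef_map rmorph_prod /=; congr ((polyseq _)`_k).
under eq_bigr => A _ do
  rewrite rmorphD rmorph1 /= map_polyZ map_polyX /= (res_prod_set _ lemd).
apply: etrans (big_subset_narrow _ l lemd
   (fun B : {set 'I_d} => 1 + (\prod_(i in B) 'X_i) *: 'X)).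
rewrite [RHS]big_mkcondr /=.
by apply: eq_bigr => A _; case: ifP; rewrite ?scale0r ?addr0.
Qed.

Lemma univ_comp_exists : {P | @univ_comp_spec k l P}.
Proof.
apply: (stable_sym (F := fun m => (genC m)`_k)).
- exact: genC_sym.
- by move=> m; apply: dhomog_msize_le; apply: genC_graded.
- by move=> m; apply: genC_res.
Qed.

Lemma univ_comp_unique P Q :
  @univ_comp_spec k l P -> univ_comp_spec Q -> P = Q.
Proof.
move=> hP hQ; apply: msym_fundamental_un.
by rewrite hP // hQ.
Qed.

End Comp.

Section Prod.
Variables (k : nat).
Local Notation R := {mpoly int[k]}.

Definition facP (A : comNzRingType) (y : 'I_k -> A) (z : A) : {poly A} :=
  1 + \sum_(j < k) (y j * z ^+ j.+1) *: 'X^(j.+1).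

Lemma coef_facP (A : comNzRingType) (y : 'I_k -> A) z (j : nat) :
  (facP y z)`_j = if j is j'.+1 then
     (if insub j' is Some i then y i * z ^+ j else 0) else 1.
Proof.
rewrite /facP coefD coef1 coef_sum; case: j => [|j] /=.
  by rewrite big1 ?addr0 // => i _; rewrite coefZ coefXn mulr0.
rewrite add0r; case: insubP => [i ltj ij|]; last first.
  rewrite -leqNgt => lekj; rewrite big1 // => i _.
  rewrite coefZ coefXn eqSS eqn_leq [(j <= i)%N]leqNgt.
  by rewrite (leq_trans (ltn_ord i) lekj) mulr0.
rewrite (bigD1 i) //= coefZ coefXn ij eqxx mulr1 big1 ?addr0 // => i' ne.
rewrite coefZ coefXn eqSS -ij; case: eqP => [/val_inj e|]; rewrite ?mulr0 //.
by rewrite e eqxx in ne.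
Qed.

Lemma map_facP (A B : comNzRingType) (f : {rmorphism A -> B}) y z :
  map_poly f (facP y z) = facP (f \o y) (f z).
Proof.
rewrite /facP rmorphD rmorph1 rmorph_sum /=; congr (_ + _).
by apply: eq_bigr => j _; rewrite map_polyZ map_polyXn rmorphM rmorphXn.
Qed.

Lemma facP0 (A : comNzRingType) (y : 'I_k -> A) : facP y 0 = 1.
Proof.
by rewrite /facP big1 ?addr0 // => j _; rewrite expr0n mulr0 scale0r.
Qed.

Lemma eq_facP (A : comNzRingType) (y y' : 'I_k -> A) z :
  y =1 y' -> facP y z = facP y' z.
Proof. by move=> yy; congr (_ + _); apply: eq_bigr => j _; rewrite yy. Qed.

Definition genP m : {poly {mpoly R[m]}} :=
  \prod_(i < m) facP (fun j : 'I_k => ('X_j : R)%:MP) 'X_i.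

Lemma genP_sym m : (genP m)`_k \is symmetric.
Proof.
apply/issymP=> s; rewrite coef_msym rmorph_prod; congr ((polyseq _)`_k).
rewrite /genP [RHS](reindex_inj (@perm_inj _ s)) /=; apply: eq_bigr => i _.
rewrite map_facP /= msymXU; apply: eq_facP => j /=.
exact: mmapC.
Qed.

Lemma genP_graded m : graded 1 (genP m).
Proof.
apply: graded_prod => i _ j; rewrite coef_facP muln1.
case: j => [|j]; first exact: dhomog1.
case: insub => [j'|]; last exact: rpred0.
rewrite mul_mpolyC; apply: rpredZ; rewrite mpolyXn dhomogX /=.
by rewrite mdegMn mdeg1 mul1n.
Qed.

Lemma genP_res m d : (d <= m)%N -> res d (genP m)`_k = (genP d)`_k.
Proof.
move=> lemd; rewrite -coef_map rmorph_prod /=; congr ((polyseq _)`_k).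
rewrite (bigID (fun i : 'I_m => (i < d)%N)) /= [X in _ * X]big1 ?mulr1.
  rewrite (big_ord_narrow lemd); apply: eq_bigr => i _.
  rewrite map_facP /= resXE /= (resX_lt _ (ltn_ord i)).
  rewrite (_ : Ordinal _ = i); last exact: val_inj.
  by apply: eq_facP => j /=; rewrite resC.
by move=> i; rewrite -leqNgt => lei; rewrite map_facP /= resXE resX_ge // facP0.
Qed.

(* evaluation of the X's at x and of the Y's at y, {mpoly R[n]} being read as
   Z[Y][X] *)
Definition flat m (y : 'I_k -> {mpoly int[m]}) n (x : 'I_n -> {mpoly int[m]}) :
  {mpoly R[n]} -> {mpoly int[m]} :=
  mmap (mmap (@mpolyC m int) y) x.
HB.instance Definition _ m y n x :=
  GRing.RMorphism.copy (@flat m y n x) (mmap (mmap (@mpolyC m int) y) x).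

Lemma flatC m y n x c : @flat m y n x c%:MP = mmap (@mpolyC m int) y c.
Proof. exact: mmapC. Qed.

Lemma flatX m y n x i : @flat m y n x 'X_i = x i.
Proof. by rewrite /flat mmapX mmap1U. Qed.

Definition eS m i : {mpoly int[m + m]} :=
  mesym m int i \mPo [tuple 'X_(lshift m j) | j < m].
Definition eT m i : {mpoly int[m + m]} :=
  mesym m int i \mPo [tuple 'X_(rshift m j) | j < m].

Lemma mesym_comp n m (x : n.-tuple {mpoly int[m]}) j :
  mesym n int j \mPo x
  = \sum_(B : {set 'I_n} | #|B| == j) \prod_(i in B) tnth x i.
Proof.
rewrite /mesym rmorph_sum; apply: eq_bigr => B _; rewrite rmorph_prod.
by apply: eq_bigr => i _ /=; rewrite /comp_mpoly mmapX mmap1U.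
Qed.

Lemma facP_prod m i j : (j <= k)%N ->
  (facP (fun j => eT m j.+1) 'X_(lshift m i))`_j
  = (\prod_(b < m) (1 + ('X_(lshift m i) * 'X_(rshift m b)) *: 'X))`_j.
Proof.
rewrite prod_1DX coef_facP => lejk.
have -> : \sum_(B : {set 'I_m} | #|B| == j)
     \prod_(i0 in B) ('X_(lshift m i) * 'X_(rshift m i0))
   = eT m j * 'X_(lshift m i) ^+ j.
  rewrite /eT mesym_comp mulr_suml; apply: eq_bigr => B /eqP <-.
  rewrite big_split prodr_const mulrC; congr (_ * _).
  by apply: eq_bigr => i0 _; rewrite tnth_mktuple.
case: j lejk => [_|j ltj]; last by rewrite insubT.
by rewrite expr0 mulr1 /eT mesym0E comp_mpoly1.
Qed.

Lemma flat_genP m :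
  flat (fun j => eT m j.+1) (fun i => 'X_(lshift m i)) (genP m)`_k
  = (\prod_(i < m) \prod_(j < m)
         (1 + ('X_(lshift m i) * 'X_(rshift m j)) *: 'X))`_k.
Proof.
rewrite -coef_map rmorph_prod /=; apply: eq_coef_prod => i j lejk.
rewrite -(facP_prod i lejk) map_facP.
rewrite [X in facP _ X]flatX.
rewrite (@eq_facP _ _ (fun j0 : 'I_k => eT m j0.+1)) // => j'.
by rewrite [LHS]flatC mmapX mmap1U.
Qed.

Lemma univ_prod_specE P :
  univ_prod_spec P <-> forall m, (k <= m)%N ->
   mmap (@mpolyC _ _) (fun i : 'I_(k + k) =>
      match split i with inl a => eS m a.+1 | inr b => eT m b.+1 end) P
   = (\prod_(i < m) \prod_(j < m)
         (1 + ('X_(lshift m i) * 'X_(rshift m j)) *: 'X))`_k.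
Proof.
by split=> h m lekm; rewrite -h //; apply: mmap_ext => i; rewrite tnth_mktuple.
Qed.

Lemma univ_prod_exists : {P | @univ_prod_spec k P}.
Proof.
have genP_size m : (msize (genP m)`_k <= k.+1)%N.
  by apply: dhomog_msize_le; have := @genP_graded m k; rewrite muln1.
have [P PE] := stable_sym genP_sym genP_size (fun m => @genP_res m k).
exists (flat (fun j => 'X_(rshift k j)) (fun i => 'X_(lshift k i)) P).
apply/univ_prod_specE => m lekm; rewrite -flat_genP -(PE m lekm).
set h := fun i : 'I_(k + k) => _.
pose g : {rmorphism {mpoly R[k]} -> {mpoly int[m + m]}} :=
  mmap (@mpolyC _ int) h \o flat (fun j => 'X_(rshift k j)) (fun i => 'X_(lshift k i)).
pose g' : {rmorphism {mpoly R[k]} -> {mpoly int[m + m]}} :=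
  flat (fun j => eT m j.+1) (fun i => 'X_(lshift m i))
    \o comp_mpoly [tuple mesym m R i.+1 | i < k].
rewrite -[LHS]/(g P) -[RHS]/(g' P); apply: mpoly_rmorph_eq => [c|i] /=.
  rewrite flatC comp_mpolyC flatC.
  pose g1 : {rmorphism R -> {mpoly int[m + m]}} :=
    mmap (@mpolyC _ int) h \o mmap (@mpolyC _ int) (fun j => 'X_(rshift k j)).
  apply: (@mpoly_rmorph_eq _ _ _ g1 (mmap (@mpolyC _ int) _)) => [d|j] /=.
    by rewrite !mmapC.
  rewrite !mmapX !mmap1U mmapX mmap1U /h.
  by case: split_ordP => j' /eqP; rewrite ?eq_rlshift // eq_rshift => /eqP ->.
rewrite flatX mmapX mmap1U /comp_mpoly mmapX mmap1U tnth_mktuple /h.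
case: split_ordP => j /eqP; rewrite ?eq_lrshift // eq_lshift => /eqP <-.
rewrite /eS mesym_comp /mesym rmorph_sum; apply: eq_bigr => B _.
rewrite rmorph_prod; apply: eq_bigr => a _ /=.
by rewrite flatX tnth_mktuple.
Qed.

Lemma univ_prod_unique P Q :
  @univ_prod_spec k P -> univ_prod_spec Q -> P = Q.
Proof.
move=> /univ_prod_specE hP /univ_prod_specE hQ.
pose u n : 'I_(n + n) -> {mpoly {mpoly int[n]}[n]} := fun i =>
  match split i with inl a => 'X_a | inr b => ('X_b)%:MP end.
pose unflat n : {rmorphism {mpoly int[n + n]} -> {mpoly {mpoly int[n]}[n]}} :=
  mmap (@mpolyC n _ \o @mpolyC n int) (u n).
have unflatK : cancel (unflat k)
    (flat (fun j => 'X_(rshift k j)) (fun i => 'X_(lshift k i))).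
  pose g : {rmorphism {mpoly int[k + k]} -> {mpoly int[k + k]}} :=
    flat (fun j => 'X_(rshift k j)) (fun i => 'X_(lshift k i)) \o unflat k.
  move=> p; rewrite -[LHS]/(g p); apply: (@mpoly_rmorph_eq _ _ _ g idfun).
    by move=> c /=; rewrite mmapC /= flatC mmapC.
  move=> i /=; rewrite mmapX mmap1U /u; case: split_ordP => j ->.
    exact: flatX.
  by rewrite flatC mmapX mmap1U.
apply: (can_inj unflatK).
pose eY : {rmorphism R -> R} := comp_mpoly [tuple mesym k int j.+1 | j < k].
have eY_inj : injective eY by move=> c d; apply: msym_fundamental_un.
have inj_map := @map_mpoly_inj _ k _ _ eY_inj.
apply: inj_map; apply: msym_fundamental_un.
have key p : map_mpoly eY (unflat k p) \mPo [tuple mesym k R i.+1 | i < k]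
   = unflat k (mmap (@mpolyC _ _) (fun i : 'I_(k + k) =>
      match split i with inl a => eS k a.+1 | inr b => eT k b.+1 end) p).
  set h := fun i : 'I_(k + k) => _.
  pose g : {rmorphism {mpoly int[k + k]} -> {mpoly R[k]}} :=
    comp_mpoly [tuple mesym k R i.+1 | i < k] \o (map_mpoly eY \o unflat k).
  pose g' : {rmorphism {mpoly int[k + k]} -> {mpoly R[k]}} :=
    unflat k \o mmap (@mpolyC _ int) h.
  rewrite -[LHS]/(g p) -[RHS]/(g' p); apply: mpoly_rmorph_eq => [c|i] /=.
    by rewrite !mmapC /= map_mpolyC /= comp_mpolyC /eY /= comp_mpolyC.
  rewrite !mmapX !mmap1U /h /u; case: split_ordP => j _.
    rewrite map_mpolyX /comp_mpoly mmapX mmap1U tnth_mktuple.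
    rewrite /eS mesym_comp rmorph_sum; apply: eq_bigr => B _.
    rewrite rmorph_prod; apply: eq_bigr => a _.
    rewrite tnth_mktuple /= mmapX mmap1U /u; case: split_ordP => b /eqP.
      by rewrite eq_lshift => /eqP ->.
    by rewrite eq_lrshift.
  rewrite map_mpolyC comp_mpolyC /eY /= /comp_mpoly mmapX mmap1U tnth_mktuple.
  rewrite /eT mesym_comp /mesym !rmorph_sum; apply: eq_bigr => B _.
  rewrite !rmorph_prod; apply: eq_bigr => a _.
  rewrite tnth_mktuple /= mmapX mmap1U /u; case: split_ordP => b /eqP.
    by rewrite eq_rlshift.
  by rewrite eq_rshift => /eqP ->.
apply: etrans (key P) (etrans _ (esym (key Q))).
have PQ := etrans (hP k (leqnn k)) (esym (hQ k (leqnn k))).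
exact (f_equal (fun p => unflat k p) PQ).
Qed.

End Prod.

(* P_k and P_(k,l); they are the only polynomials meeting their specification
   by univ_prod_unique and univ_comp_unique. *)
Definition univ_prod k : {mpoly int[k + k]} := sval (univ_prod_exists k).

Definition univ_comp k l : {mpoly int[k * l]} := sval (univ_comp_exists k l).

Lemma univ_prodP k : univ_prod_spec (univ_prod k).
Proof. exact: svalP (univ_prod_exists k). Qed.

Lemma univ_compP k l : @univ_comp_spec k l (univ_comp k l).
Proof. exact: svalP (univ_comp_exists k l). Qed.

Section ConstantTerm.
Variable n : nat.

Lemma mcoeff0_comp m (x : n.-tuple {mpoly int[m]}) (P : {mpoly int[n]}) :
  (forall i, (tnth x i)@_0%MM = 0) -> (P \mPo x)@_0%MM = P@_0%MM.
Proof.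
move=> x0; pose g : {rmorphism {mpoly int[n]} -> int} :=
  mcoeff (0%MM : 'X_{1..m}) \o comp_mpoly x.
rewrite -[LHS]/(g P); apply: (@mpoly_rmorph_eq _ _ _ g (mcoeff 0%MM)).
  by move=> c /=; rewrite comp_mpolyC !mcoeffC !eqxx.
move=> i /=; rewrite /comp_mpoly mmapX mmap1U x0 mcoeffX.
by case: eqP => // /(congr1 mdeg); rewrite mdeg1 mdeg0.
Qed.

Lemma mcoeff0_mesym i : (mesym n int i.+1)@_0%MM = 0.
Proof. by rewrite mcoeff_mesym /mechar mdeg0. Qed.

Lemma mcoeff0_X (i : 'I_n) : ('X_i : {mpoly int[n]})@_0%MM = 0.
Proof.
by rewrite mcoeffX; case: eqP => // /(congr1 mdeg); rewrite mdeg1 mdeg0.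
Qed.

Lemma mcoeff0_prod (I : finType) (p : pred I) (c : I -> {mpoly int[n]}) k :
  (0 < k)%N -> (forall i, p i -> (c i)@_0%MM = 0) ->
  ((\prod_(i | p i) (1 + c i *: 'X))`_k)@_0%MM = 0.
Proof.
move=> k0 c0; rewrite -(coef_map (mcoeff 0%MM)) rmorph_prod /= big1.
  by rewrite coef1 (gtn_eqF k0).
by move=> i pi; rewrite rmorphD rmorph1 /= map_polyZ /= c0 // scale0r addr0.
Qed.

End ConstantTerm.

Lemma univ_comp_no_const k l :
  (0 < k)%N -> (0 < l)%N -> (univ_comp k l)@_0%MM = 0.
Proof.
move=> k0 l0; have P := @univ_compP k l _ (leqnn _).
rewrite -(mcoeff0_comp (x := [tuple mesym (k * l) int i.+1 | i < k * l])).
  rewrite P; apply: mcoeff0_prod => // A /eqP Al.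
  have /card_gt0P[i iA] : (0 < #|A|)%N by rewrite Al.
  by rewrite (bigD1 i) //= rmorphM /= mcoeff0_X mul0r.
by move=> i; rewrite tnth_mktuple mcoeff0_mesym.
Qed.

Lemma univ_prod_no_const k : (0 < k)%N -> (univ_prod k)@_0%MM = 0.
Proof.
move=> k0; have P := @univ_prodP k _ (leqnn _).
rewrite -(mcoeff0_comp (x :=
  [tuple match split i with inl a => eS k a.+1 | inr b => eT k b.+1 end
     | i < k + k])).
  rewrite P pair_big; apply: mcoeff0_prod => // i _.
  by rewrite rmorphM /= mcoeff0_X mul0r.
move=> i; rewrite tnth_mktuple; case: split => a.
  rewrite /eS mcoeff0_comp ?mcoeff0_mesym // => j.
  by rewrite tnth_mktuple mcoeff0_X.
rewrite /eT mcoeff0_comp ?mcoeff0_mesym // => j.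
by rewrite tnth_mktuple mcoeff0_X.
Qed.

HB.mixin Record Zmodule_isNonUnitalComRing K of GRing.Zmodule K := {
  numul : K -> K -> K;
  numulA : associative numul;
  numulC : commutative numul;
  numulDl : left_distributive numul +%R;
}.

#[short(type="nonUnitalComRingType")]
HB.structure Definition NonUnitalComRing :=
  {K of Zmodule_isNonUnitalComRing K & GRing.Zmodule K}.

Section NonUnitalEvaluation.
Variable K : nonUnitalComRingType.

(* There is no empty product in K; the value 0 for [::] is a dummy, met only
   at the constant monomial, which does not occur in the polynomials below
   (univ_prod_no_const, univ_comp_no_const). *)
Definition nuprod (s : seq K) : K :=
  if s is x :: s' then foldl numul x s' else 0.

Definition numonom n (v : 'I_n -> K) (mu : 'X_{1..n}) : K :=
  nuprod (flatten [seq nseq (mu i) (v i) | i : 'I_n]).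

Definition nueval n (v : 'I_n -> K) (p : {mpoly int[n]}) : K :=
  \sum_(mu <- msupp p) numonom v mu *~ p@_mu.

Lemma nueval_hom (A : comNzRingType) (f : {additive K -> A}) n
    (v : 'I_n -> K) (p : {mpoly int[n]}) :
  {morph f : x y / numul x y >-> x * y} -> p@_0%MM = 0 ->
  f (nueval v p) = mmap intr (f \o v) p.
Proof.
move=> fM p0; rewrite raddf_sum /mmap big_seq [RHS]big_seq.
apply: eq_bigr => mu mup; rewrite raddfMz -mulrzl; congr (_ * _).
have mu0 : mu != 0%MM by apply: contraTneq mup => ->; rewrite mcoeff_msupp p0 eqxx.
have fprod s : s != [::] -> f (nuprod s) = \prod_(x <- s) f x.
  case: s => // x s _; rewrite /= big_cons.
  elim: s x => [|y s IHs] x /=; first by rewrite big_nil mulr1.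
  by rewrite IHs fM big_cons mulrA.
rewrite fprod.
  rewrite big_flatten big_map big_enum /=; apply: eq_bigr => i _.
  by rewrite big_nseq -Monoid.iteropE.
apply: contra mu0 => /eqP s0; apply/eqP/mnmP => i; rewrite mnm0E.
apply/eqP; rewrite -leqn0 leqNgt; apply/negP => mui.
suff : v i \in flatten [seq nseq (mu i) (v i) | i : 'I_n] by rewrite s0.
apply/flattenP; exists (nseq (mu i) (v i)); last by rewrite mem_nseq mui /=.
by apply: map_f; rewrite mem_enum.
Qed.

End NonUnitalEvaluation.

(* Only lam k with k >= 1 is meaningful: lam 0 is an unconstrained dummy.
   The first and last summands in lamD are the terms of the convolution where
   the convention on lambda^0 applies. *)
HB.mixin Record isPreLambdaRing K of NonUnitalComRing K := {
  lam : nat -> K -> K;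
  lam1 : forall x : K, lam 1 x = x;
  lamD : forall (k : nat) (x y : K), (0 < k)%N ->
    lam k (x + y) =
      lam k x + \sum_(1 <= i < k) numul (lam (k - i)%N x) (lam i y) + lam k y;
}.

#[short(type="preLambdaRingType")]
HB.structure Definition PreLambdaRing :=
  {K of isPreLambdaRing K & NonUnitalComRing K}.

Definition product_axiom (K : preLambdaRingType) : Prop :=
  forall (x y : K) (k : nat), (0 < k)%N ->
    lam k (numul x y) =
      nueval (fun i : 'I_(k + k) => match split i with
                                    | inl a => lam a.+1 x
                                    | inr b => lam b.+1 y
                                    end)
             (univ_prod k).

Definition composition_axiom (K : preLambdaRingType) : Prop :=
  forall (x : K) (k l : nat), (0 < k)%N -> (0 < l)%N ->
    lam k (lam l x) =
      nueval (fun i : 'I_(k * l) => lam i.+1 x) (univ_comp k l).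

Definition is_lambda_ring (K : preLambdaRingType) : Prop :=
  product_axiom K /\ composition_axiom K.

(* Main.v *)
From HB Require Import structures.
From mathcomp Require Import all_boot all_algebra.
From mathcomp Require Import mpoly.
Require Import Defs.

(** Write [L x] for the generating series [1 + \sum_k lambda^k(x) t^k] over the
unitization of [K].  Since [lambda^2(x + y) = lambda^2(x) + xy + lambda^2(y)],
one has [L (lambda^2(x + y)) = L (lambda^2(x)) L (xy) L (lambda^2(y))].  By the
composition axiom all factors but [L (xy)] are universal expressions in
[L x] and [L y], and the splitting of the set of pairs of [S \cup T] into pairs
in [S], pairs in [T] and [S * T] gives the same relation with [L (xy)] replaced
by the series of the [P_k]; the invertible factors then cancel. *)

Set Implicit Arguments.
Unset Strict Implicit.
Unset Printing Implicit Defensive.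

Import GRing.Theory.
Local Open Scope ring_scope.

(** * Adjoining a unit to a non-unital commutative ring *)

Section Unitization.
Variable K : nonUnitalComRingType.

(** The adjoined unit serves as constant term of the generating series; identities descend to [K]
    because [inu] is injective. *)
Definition unitization : Type := (int * K)%type.
HB.instance Definition _ := GRing.Zmodule.on unitization.

Definition inu (x : K) : unitization := (0, x).

Lemma inu_is_additive : zmod_morphism inu.
Proof. by move=> x y; congr pair; rewrite subr0. Qed.
HB.instance Definition _ := GRing.isZmodMorphism.Build _ _ inu inu_is_additive.

Lemma inu_inj : injective inu.
Proof. by move=> x y []. Qed.

(** The fixed factor comes first, so that [numulr y] is an additive map and commutes with integer
    multiples. *)
Definition numulr (y x : K) : K := numul x y.

Lemma numulr_is_additive (y : K) : zmod_morphism (numulr y).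
Proof.
by move=> x x'; apply: (addIr (numul x' y)); rewrite /numulr -numulDl !subrK.
Qed.
HB.instance Definition _ (y : K) :=
  GRing.isZmodMorphism.Build K K (numulr y) (numulr_is_additive y).

Lemma numulDr (x y z : K) : numul x (y + z) = numul x y + numul x z.
Proof. by rewrite numulC numulDl !(numulC x). Qed.

Lemma numulzl (x y : K) (n : int) : numul (x *~ n) y = numul x y *~ n.
Proof. exact: (raddfMz (numulr y)). Qed.

Lemma numulzr (x y : K) (n : int) : numul x (y *~ n) = numul x y *~ n.
Proof. by rewrite numulC numulzl numulC. Qed.

Definition unitization_one : unitization := (1, 0).
(** Expansion of [(m + x)(n + y)], integers acting on [K] by multiples. *)
Definition unitization_mul (u v : unitization) : unitization :=
  (u.1 * v.1, u.2 *~ v.1 + v.2 *~ u.1 + numul u.2 v.2).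

Lemma unitization_mulC : commutative unitization_mul.
Proof.
move=> [m x] [n y]; rewrite /unitization_mul /=.
by congr pair; [exact: mulrC | rewrite numulC [_ *~ _ + _]addrC].
Qed.

Lemma unitization_mulA : associative unitization_mul.
Proof.
move=> [m x] [n y] [p z]; rewrite /unitization_mul /=.
congr pair; first exact: mulrA.
rewrite !mulrzDl !numulDl !numulDr !numulzl !numulzr -!mulrzA numulA.
rewrite [(p * m)%R]mulrC [(n * m)%R]mulrC.
rewrite -!addrA; congr (_ + (_ + _)).
rewrite [RHS]addrCA; congr (_ + _).
by rewrite [LHS]addrCA; congr (_ + _); rewrite [LHS]addrCA.
Qed.

Lemma unitization_mul1 : left_id unitization_one unitization_mul.
Proof.
move=> [m x]; rewrite /unitization_mul /= mul1r mul0rz add0r mulr1z.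
by rewrite [numul 0 x](raddf0 (numulr x)) addr0.
Qed.

Lemma unitization_mulDl : left_distributive unitization_mul +%R.
Proof.
move=> [m x] [n y] [p z]; rewrite /unitization_mul; congr pair => /=.
  exact: mulrDl.
rewrite mulrzDl mulrzDr numulDl -!addrA; congr (_ + _).
rewrite [LHS]addrCA; congr (_ + _); rewrite [RHS]addrCA; congr (_ + _).
exact: addrCA.
Qed.

Lemma unitization_1neq0 : unitization_one != 0.
Proof. by apply/eqP => /(congr1 fst)/eqP; rewrite oner_eq0. Qed.

HB.instance Definition _ := GRing.Zmodule_isComNzRing.Build unitization
  unitization_mulA unitization_mulC unitization_mul1 unitization_mulDl
  unitization_1neq0.

Lemma inuM : {morph inu : x y / numul x y >-> x * y}.
Proof. by move=> x y; congr pair; rewrite /= !mulr0z !add0r. Qed.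

End Unitization.

(** * Cauchy products and values of the universal polynomials *)

Section Evaluation.
Variable A : comNzRingType.
Implicit Types a b : nat -> A.

Definition conv a b n : A := \sum_(i < n.+1) a (n - i)%N * b i.

(** The shift to [a i.+1] leaves [a 0] free to be the constant coefficient of a series. *)
Definition eval_comp k l a : A :=
  mmap intr (fun i : 'I_(k * l) => a i.+1) (univ_comp k l).

Definition eval2 k a b : {mpoly int[k + k]} -> A :=
  mmap intr (fun i : 'I_(k + k) =>
    match split i with inl i => a i.+1 | inr j => b j.+1 end).
Arguments eval2 k a b : clear implicits.
HB.instance Definition _ k a b := GRing.RMorphism.on (eval2 k a b).

Definition eval_prod k a b : A := eval2 k a b (univ_prod k).

Lemma eq_conv n a a' b b' :
  (forall i, (i <= n)%N -> a i = a' i) -> (forall i, (i <= n)%N -> b i = b' i) ->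
  conv a b n = conv a' b' n.
Proof.
by move=> aa bb; apply: eq_bigr => i _; rewrite aa ?leq_subr // bb // -ltnS.
Qed.

Lemma conv_coef (p q : {poly A}) n :
  conv (fun i => p`_i) (fun i => q`_i) n = (p * q)`_n.
Proof. by rewrite coefMr. Qed.

Lemma conv0 a b : a 0%N = 1 -> b 0%N = 1 -> conv a b 0 = 1.
Proof. by move=> a0 b0; rewrite /conv big_ord1 a0 b0 mulr1. Qed.

Lemma convE a b n : conv a b n =
  (\poly_(i < n.+1) a i * \poly_(i < n.+1) b i)`_n.
Proof.
by rewrite -conv_coef; apply: eq_conv => i lein; rewrite coef_poly ltnS lein.
Qed.

Lemma convC a b n : conv a b n = conv b a n.
Proof. by rewrite !convE mulrC. Qed.

(** In degree [n] the summand at [i = 0] is [a n]; the others involve [a] only below [n], where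
    strong induction applies. *)
Lemma conv_injl a a' b : b 0%N = 1 ->
  (forall n, conv a b n = conv a' b n) -> a =1 a'.
Proof.
move=> b0 h; elim/ltn_ind => n IH; move: (h n).
rewrite /conv !big_ord_recl /= subn0 b0 !mulr1.
under eq_bigr => i _ do
  rewrite IH ?ltn_subrL ?(leq_ltn_trans _ (ltn_ord i)) //.
exact: addIr.
Qed.

Lemma eq_eval_comp k l a a' :
  (forall i, (i <= k * l)%N -> a i = a' i) -> eval_comp k l a = eval_comp k l a'.
Proof. by move=> aa; apply: mmap_ext => i; apply: aa. Qed.

Lemma eq_eval2 k a a' b b' :
  (forall i, (i <= k)%N -> a i = a' i) -> (forall i, (i <= k)%N -> b i = b' i) ->
  eval2 k a b =1 eval2 k a' b'.
Proof.
by move=> aa bb p; apply: mmap_ext => i; case: split => j; [apply: aa|apply: bb].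
Qed.

End Evaluation.
Arguments eval2 {A} k a b _.

Lemma rmorph_mmap_intr (A B : comNzRingType) (g : {rmorphism A -> B}) n
    (v : 'I_n -> A) p : g (mmap intr v p) = mmap intr (g \o v) p.
Proof.
rewrite /mmap rmorph_sum; apply: eq_bigr => mu _; rewrite rmorphM rmorph_int.
by congr (_ * _); rewrite rmorph_prod; apply: eq_bigr => i _; rewrite rmorphXn.
Qed.

(** Identifies composition of polynomials, used in the specifications, with evaluation in an
    arbitrary ring. *)
Lemma mmap_mpolyC_intr m n (v : 'I_n -> {mpoly int[m]}) p :
  mmap (@mpolyC m int) v p = mmap intr v p.
Proof. by apply: mmap_extf => c; rewrite -(rmorph_int (@mpolyC m int)) intz. Qed.

(** * Compatibility with ring morphisms *)

Section Naturality.
Variables (A B : comNzRingType) (g : {rmorphism A -> B}).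
Implicit Types a b : nat -> A.

Lemma rmorph_conv a b n : g (conv a b n) = conv (g \o a) (g \o b) n.
Proof. by rewrite rmorph_sum; apply: eq_bigr => i _; rewrite rmorphM. Qed.

Lemma rmorph_eval_comp k l a : g (eval_comp k l a) = eval_comp k l (g \o a).
Proof. exact: rmorph_mmap_intr. Qed.

Lemma rmorph_eval_prod k a b :
  g (eval_prod k a b) = eval_prod k (g \o a) (g \o b).
Proof.
by rewrite [LHS]rmorph_mmap_intr; apply: mmap_ext => i /=; case: split.
Qed.

End Naturality.

(** * Products over two-element subsets *)

Section Pairs.
Variable A : comNzRingType.

Definition pairs_poly n (x : 'I_n -> A) : {poly A} :=
  \prod_(B : {set 'I_n} | #|B| == 2) (1 + (\prod_(i in B) x i) *: 'X).

Lemma eq_pairs_poly n (x y : 'I_n -> A) :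
  x =1 y -> pairs_poly x = pairs_poly y.
Proof.
by move=> xy; apply: eq_bigr => B _; rewrite (eq_bigr y) // => i _; exact: xy.
Qed.

(** Each two-element set is listed by its increasing pair, which lets [big_split_ord] cut the index
    range. *)
Lemma pairs_polyE n (x : 'I_n -> A) :
  pairs_poly x = \prod_(i < n) \prod_(j < n | (i < j)%N) (1 + (x i * x j) *: 'X).
Proof.
rewrite pair_big_dep /=.
pose D := [set p : 'I_n * 'I_n | (p.1 < p.2)%N].
pose h (p : 'I_n * 'I_n) := [set p.1; p.2].
have hinj : {in D &, injective h}.
  move=> [i j] [i' j']; rewrite !inE /= => ij ij' /setP e.
  move: (e i) (e j) (e i'); rewrite !inE !eqxx ?orbT /=.
  case: (eqVneq i i') => [<-|_] /=.
    by case: (eqVneq j i) ij => [->|_ _]; [rewrite ltnn | move=> _ /esym /eqP ->].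
  move=> /esym/eqP e1; subst j'.
  case: (eqVneq j i') => [e2|_]; first by subst i'; rewrite ltnNge ltnW in ij'.
  by move=> /esym/eqP e2; subst j; rewrite ltnn in ij.
have DE : [set B : {set 'I_n} | #|B| == 2] = h @: D.
  apply/setP => B; rewrite inE; apply/cards2P/imsetP.
    move=> [i [j [ne ->]]]; case: (ltngtP i j) => lt.
    - by exists (i, j); first by rewrite inE.
    - by exists (j, i); [rewrite inE | rewrite /h setUC].
    - by move/val_inj: lt ne => ->; rewrite eqxx.
  move=> [[i j]]; rewrite inE /= => ij ->; exists i, j; split=> //.
  by apply: contraTneq ij => ->; rewrite ltnn.
transitivity (\prod_(B in h @: D) (1 + (\prod_(i in B) x i) *: 'X)).
  by rewrite -DE; apply: eq_bigl => B; rewrite inE.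
rewrite big_imset //=; apply: eq_big => [p|p]; rewrite inE // => lt.
rewrite /h big_setU1 ?big_set1 //= inE.
by apply: contraTneq lt => ->; rewrite ltnn.
Qed.

(** Every left index is below every right index, so mixed increasing pairs are exactly the pairs
    (left, right). *)
Lemma pairs_poly_split m n (x : 'I_(m + n) -> A) :
  pairs_poly x = pairs_poly (x \o @lshift m n) * pairs_poly (x \o @rshift m n)
    * \prod_(i < m) \prod_(j < n) (1 + (x (lshift n i) * x (rshift m j)) *: 'X).
Proof.
rewrite !pairs_polyE big_split_ord /= mulrAC -big_split /=; congr (_ * _).
  apply: eq_bigr => i _; rewrite big_split_ord /=; congr (_ * _).
  by apply: eq_bigl => j; rewrite /= ltn_addr.
apply: eq_bigr => i _; rewrite big_split_ord /= big_pred0 ?mul1r.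
  by apply: eq_bigl => j; rewrite ltn_add2l.
by move=> j /=; rewrite ltnNge ltnW // ltn_addr.
Qed.

End Pairs.

Lemma map_pairs_poly (A B : comNzRingType) (g : {rmorphism A -> B}) n
    (x : 'I_n -> A) : map_poly g (pairs_poly x) = pairs_poly (g \o x).
Proof.
rewrite rmorph_prod; apply: eq_bigr => C _.
by rewrite rmorphD rmorph1 /= map_polyZ map_polyX rmorph_prod.
Qed.

(** * From elementary symmetric polynomials to arbitrary series *)

Lemma eval_comp_mesym k m : (k * 2 <= m)%N ->
  eval_comp k 2 (mesym m int) = (pairs_poly (fun i : 'I_m => 'X_i))`_k.
Proof.
move=> lem; rewrite -[RHS](univ_compP lem) /comp_mpoly mmap_mpolyC_intr.
by apply: mmap_ext => i; rewrite tnth_mktuple.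
Qed.

Lemma eval2_eST k m P :
  eval2 k (eS m) (eT m) P = P \mPo
    [tuple match split i with
           | inl a => mesym m int a.+1 \mPo [tuple 'X_(lshift m j) | j < m]
           | inr b => mesym m int b.+1 \mPo [tuple 'X_(rshift m j) | j < m]
           end | i < k + k].
Proof.
rewrite /comp_mpoly mmap_mpolyC_intr; apply: mmap_ext => i.
by rewrite tnth_mktuple.
Qed.

Lemma comp_mpoly_tupleX m n (v : 'I_n -> {mpoly int[m]}) i :
  'X_i \mPo [tuple v j | j < n] = v i.
Proof. by rewrite /comp_mpoly mmapX mmap1U tnth_mktuple. Qed.

Lemma eval_comp_comp_mesym k m n (v : 'I_m -> {mpoly int[n]}) :
  (k * 2 <= m)%N ->
  eval_comp k 2 (fun i => mesym m int i \mPo [tuple v j | j < m])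
  = (pairs_poly v)`_k.
Proof.
move=> lem; pose g : {rmorphism _ -> _} := comp_mpoly [tuple v j | j < m].
rewrite -[LHS](rmorph_eval_comp g) eval_comp_mesym // -coef_map map_pairs_poly.
congr ((polyseq _)`_k); apply: eq_pairs_poly => i; exact: comp_mpoly_tupleX.
Qed.

Lemma mesym_coef n m (v : 'I_n -> {mpoly int[m]}) k :
  mesym n int k \mPo [tuple v j | j < n] = (\prod_(i < n) (1 + v i *: 'X))`_k.
Proof.
rewrite mesym_comp prod_1DX; apply: eq_bigr => B _; apply: eq_bigr => i _.
by rewrite tnth_mktuple.
Qed.

Lemma conv_eST m k : conv (eS m) (eT m) k = mesym (m + m) int k.
Proof.
rewrite [RHS](_ : _ = (\prod_(i < m + m) (1 + 'X_i *: 'X))`_k); last first.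
  by rewrite prod_1DX.
rewrite big_split_ord /= -conv_coef; apply: eq_conv => i _;
  exact: mesym_coef.
Qed.

(** Coefficient of [t^k] in [pairs_poly_split] for the variables [S] and [T]: the mixed pairs yield
    [univ_prod]. The bound on [m] covers the specifications of all [univ_comp i 2] with [i <= k]. *)
Lemma eval_comp_conv_eST k m : (k * 2 <= m)%N ->
  eval_comp k 2 (conv (eS m) (eT m))
  = conv (conv (fun i => eval_comp i 2 (eS m)) (fun i => eval_comp i 2 (eT m)))
         (fun i => eval_prod i (eS m) (eT m)) k.
Proof.
move=> lem; have lei i : (i <= k)%N -> (i * 2 <= m)%N.
  by move=> leik; rewrite (leq_trans _ lem) // leq_mul2r leik orbT.
rewrite (eq_eval_comp (a' := mesym (m + m) int)); last by move=> i _; exact: conv_eST.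
rewrite eval_comp_mesym ?(leq_trans lem) ?leq_addr // pairs_poly_split -conv_coef.
apply: eq_conv => i leik; rewrite -?conv_coef.
  apply: eq_conv => j leji; rewrite -eval_comp_comp_mesym // lei //;
    exact: leq_trans leik.
rewrite /eval_prod eval2_eST -univ_prodP //.
by rewrite (leq_trans _ (lei i leik)) // leq_pmulr.
Qed.

(* Algebraic independence of the e_i(S), e_j(T): adding P to [univ_prod k] would
   not affect its specification. *)
Lemma eval2_eST_eq0 k P :
  (forall m, (k <= m)%N -> eval2 k (eS m) (eT m) P = 0) -> P = 0.
Proof.
move=> P0; apply: (addrI (univ_prod k)); rewrite addr0.
apply: univ_prod_unique; last exact: univ_prodP.
move=> m lekm; rewrite -univ_prodP // -!eval2_eST rmorphD /=.
by rewrite P0 ?addr0.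
Qed.

(** Generic series with constant term 1, truncated after degree [n]; [eval2 n a b] specializes it to
    [a] or [b] up to that degree. *)
Definition gen_var n (s : 'I_n -> 'I_(n + n)) (i : nat) : {mpoly int[n + n]} :=
  if i is i'.+1 then oapp (fun j => 'X_(s j)) 0 (insub i') else 1.

Lemma eval2_gen_varl (A : comNzRingType) n (a b : nat -> A) i : a 0%N = 1 ->
  (i <= n)%N -> eval2 n a b (gen_var (@lshift n n) i) = a i.
Proof.
move=> a0; case: i => [|i] lein /=; first by rewrite rmorph1.
rewrite insubT /= /eval2 mmapX mmap1U; case: split_ordP => j /eqP.
  by rewrite eq_lshift => /eqP <-.
by rewrite eq_lrshift.
Qed.

Lemma eval2_gen_varr (A : comNzRingType) n (a b : nat -> A) i : b 0%N = 1 ->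
  (i <= n)%N -> eval2 n a b (gen_var (@rshift n n) i) = b i.
Proof.
move=> b0; case: i => [|i] lein /=; first by rewrite rmorph1.
rewrite insubT /= /eval2 mmapX mmap1U; case: split_ordP => j /eqP.
  by rewrite eq_rlshift.
by rewrite eq_rshift => /eqP <-.
Qed.

(** Both sides specialize from generic series, and for those the identity may be tested on [eS m]
    and [eT m] by algebraic independence. *)
Lemma eval_comp_conv (A : comNzRingType) (a b : nat -> A) k :
  a 0%N = 1 -> b 0%N = 1 ->
  eval_comp k 2 (conv a b)
  = conv (conv (fun i => eval_comp i 2 a) (fun i => eval_comp i 2 b))
         (fun i => eval_prod i a b) k.
Proof.
(* The highest degree of [a] and [b] read by either side. *)
pose n := (k * 2)%N.
pose L (B : comNzRingType) (c d : nat -> B) := eval_comp k 2 (conv c d).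
pose M (B : comNzRingType) (c d : nat -> B) :=
  conv (conv (fun i => eval_comp i 2 c) (fun i => eval_comp i 2 d))
       (fun i => eval_prod i c d) k.
pose u := gen_var (@lshift n n); pose v := gen_var (@rshift n n).
have lekn i j : (i <= k)%N -> (j <= i * 2)%N -> (j <= n)%N.
  by move=> ik ji; rewrite (leq_trans ji) // leq_mul2r ik orbT.
have evalL (B : comNzRingType) (c d : nat -> B) : c 0%N = 1 -> d 0%N = 1 ->
    eval2 n c d (L _ u v) = L _ c d.
  move=> c0 d0; rewrite /L rmorph_eval_comp; apply: eq_eval_comp => i lei /=.
  rewrite rmorph_conv; apply: eq_conv => j leji /=.
    by rewrite eval2_gen_varl // (leq_trans leji).
  by rewrite eval2_gen_varr // (leq_trans leji).
have evalM (B : comNzRingType) (c d : nat -> B) : c 0%N = 1 -> d 0%N = 1 ->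
    eval2 n c d (M _ u v) = M _ c d.
  move=> c0 d0; rewrite /M rmorph_conv; apply: eq_conv => i leik /=.
    rewrite rmorph_conv; apply: eq_conv => j leji /=;
      rewrite rmorph_eval_comp; apply: eq_eval_comp => r ler /=.
      by rewrite eval2_gen_varl // (lekn j) // (leq_trans leji).
    by rewrite eval2_gen_varr // (lekn j) // (leq_trans leji).
  rewrite rmorph_eval_prod; apply: eq_eval2 => r ler /=.
    by rewrite eval2_gen_varl // (lekn i) // (leq_trans ler) ?leq_pmulr.
  by rewrite eval2_gen_varr // (lekn i) // (leq_trans ler) ?leq_pmulr.
have LM : L _ u v - M _ u v = 0.
  apply: eval2_eST_eq0 => m lenm.
  have e0 : eS m 0 = 1 /\ eT m 0 = 1 by rewrite /eS /eT mesym0E !comp_mpoly1.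
  rewrite rmorphB /= evalL ?evalM ?e0.1 ?e0.2 //.
  by rewrite [L _ _ _]eval_comp_conv_eST // subrr.
move=> a0 b0; rewrite -[LHS]evalL // -[RHS]evalM //.
by move/subr0_eq: LM => ->.
Qed.

(** The product defining [univ_comp 0 l] has value 1 at [t = 0], so uniqueness forces the polynomial
    1. *)
Lemma eval_comp0 (A : comNzRingType) (a : nat -> A) l : eval_comp 0 l a = 1.
Proof.
rewrite /eval_comp (_ : univ_comp 0 l = 1) ?rmorph1 //.
apply: univ_comp_unique; first exact: univ_compP.
move=> m _; rewrite comp_mpoly1 -horner_coef0 horner_prod big1 // => B _.
by rewrite !hornerE.
Qed.

(** * The generating series of the lambda operations *)

Section LambdaSeries.
Variable K : preLambdaRingType.

Definition lseries (x : K) (k : nat) : unitization K :=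
  if k is 0 then 1 else inu (lam k x).

Lemma lseriesD x y : lseries (x + y) =1 conv (lseries x) (lseries y).
Proof.
case=> [|k]; first by rewrite conv0.
rewrite /= lamD // !raddfD /= /conv big_ord_recl big_ord_recr /= subn0 mulr1.
rewrite /bump /= add1n subnn mul1r addrA; congr (_ + _ + _).
rewrite big_add1 /= big_mkord raddf_sum; apply: eq_bigr => i _ /=.
(* Both indices of an inner summand are positive, so [lseries] gives [inu (lam _ _)] there. *)
rewrite add1n inuM subSS; have := subn_gt0 i k; rewrite ltn_ord.
by case: (k - i)%N.
Qed.

Hypothesis K_comp : composition_axiom K.

Lemma lseries_lam x l : (0 < l)%N ->
  lseries (lam l x) =1 (fun k => eval_comp k l (lseries x)).
Proof.
move=> l0 [|k]; first by rewrite eval_comp0.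
rewrite /= K_comp // (nueval_hom _ (@inuM K)) ?univ_comp_no_const //.
Qed.

Lemma lseries_mul x y :
  lseries (numul x y) =1 (fun k => eval_prod k (lseries x) (lseries y)).
Proof.
pose cx k := eval_comp k 2 (lseries x); pose cy k := eval_comp k 2 (lseries y).
have lam2D : lam 2 (x + y) = numul x y + (lam 2 x + lam 2 y).
  by rewrite lamD // big_nat1 !lam1 addrAC addrC.
(* The factor to cancel is the product of the series of [lam 2 x] and [lam 2 y]. *)
apply: (@conv_injl _ _ _ (conv cx cy)).
  by rewrite conv0 // /cx /cy eval_comp0.
(* One side comes from additivity applied to [lam2D], the other from the composition axiom at
   [x + y] and [eval_comp_conv]. *)
move=> k; transitivity (lseries (lam 2 (x + y)) k).
  rewrite lam2D lseriesD; apply: eq_conv => // i _.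
  by rewrite lseriesD; apply: eq_conv => j _; rewrite lseries_lam.
rewrite lseries_lam // convC -eval_comp_conv //.
by apply: eq_eval_comp => i _; exact: lseriesD.
Qed.

End LambdaSeries.

Theorem proposition4p1 (K : preLambdaRingType) :
  composition_axiom K -> is_lambda_ring K.
Proof.
move=> K_comp; split=> // x y k k0; apply: inu_inj.
(* For [k > 0] there is no constant term, so [inu] carries the value in [K] to the value in the
   unitization. *)
rewrite (nueval_hom _ (@inuM K)) ?univ_prod_no_const //.
transitivity (lseries (numul x y) k); first by case: k k0.
rewrite lseries_mul //; apply: mmap_ext => i /=.
by case: split.
Qed.
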